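(* Let $Q$ be a quandle. The following statements are equivalent: (1) $Q$ is quasi-affine, i.e. $Q$ is isomorphic to a subquandle of an affine quandle; (2) the displacement group $\mathrm{Dis}(Q)$ is abelian and acts semiregularly on $Q$; (3) $Q$ is isomorphic to a semiregular extension $\mathrm{Ext}(A,f,\bar d)$ for some abelian group $A$, some automorphism $f$ of $A$ and some tuple $\bar d=(d_i:i\in I)$ of elements of $A$ (and in that case the extension can be taken indecomposable); (4) $Q$ is abelian in the sense of universal algebra (the term condition).
   Context: A quandle is a nonempty set $Q$ with a binary operation $*$ such that $x*x=x$; for all $x,y$ there is a unique $z$ with $x*z=y$ (denoted $z=x\backslash y$); and $x*(y*z)=(x*y)*(x*z)$. Left translations are $L_x(y)=x*y$. A subquandle is a subset closed under $*$ and $\backslash$. The displacement group is the permutation group $\mathrm{Dis}(Q)=\langle L_aL_b^{-1}: a,b\in Q\rangle$ on $Q$; the orbits of $Q$ are the orbits of $\mathrm{Dis}(Q)$ acting on $Q$. A permutation group $G$ on $X$ is semiregular if $g(x)\ne x$ for every $1\neq g\in G$ and every $x\in X$. For an abelian group $A$ and $f\in\mathrm{Aut}(A)$, the affine quandle $\mathrm{Aff}(A,f)$ is the set $A$ with $a*b=(1-f)(a)+f(b)$ (here $1$ is the identity map). A quandle is affine if it is isomorphic to some $\mathrm{Aff}(A,f)$. For an abelian group $A$, $f\in\mathrm{Aut}(A)$, a nonempty set $I$ and a tuple $\bar d=(d_i:i\in I)$ of elements of $A$, the semiregular extension $\mathrm{Ext}(A,f,\bar d)$ is the quandle on $I\times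 A$ with $(i,a)*(j,b)=(j,(1-f)(a)+f(b)+d_i-d_j)$. It is called indecomposable if its orbits are exactly the fibers $\{i\}\times A$, $i\in I$. An algebraic structure $Q$ is abelian (term condition) if for every $k$, every $(k+1)$-ary term operation $t$ and all $a,b,u_1,\dots,u_k,v_1,\dots,v_k\in Q$: $t(a,u_1,\dots,u_k)=t(a,v_1,\dots,v_k)$ implies $t(b,u_1,\dots,u_k)=t(b,v_1,\dots,v_k)$. For quandles, terms are formed using both operations $*$ and $\backslash$. *)

(* Defs.v *)
From HB Require Import structures.
From mathcomp Require Import all_boot all_order all_algebra.
From mathcomp Require Import boolp classical_sets.

Set Implicit Arguments.
Unset Strict Implicit.
Unset Printing Implicit Defensive.

Import GRing.Theory.

Local Open Scope classical_set_scope.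
Local Open Scope ring_scope.

Declare Scope quandle_scope.
Delimit Scope quandle_scope with qdl.

Record quandle := Quandle {
  carrier :> Type;
  qop : carrier -> carrier -> carrier;
  quandle_nonempty : inhabited carrier;
  qop_idem : forall x, qop x x = x;
  qop_unique_div : forall x y, exists! z, qop x z = y;
  qop_distr : forall x y z, qop x (qop y z) = qop (qop x y) (qop x z) }.

Definition qldiv (Q : quandle) (x y : Q) : Q := projT1 (cid (qop_unique_div x y)).

Notation "x * y" := (qop x y) : quandle_scope.
Notation "x \\ y" := (qldiv x y) (at level 40, left associativity) : quandle_scope.

Lemma qldivP (Q : quandle) (x y z : Q) : (x * z = y <-> z = x \\ y)%qdl.
Proof.
rewrite /qldiv; case: cid => w [/= xw uw].
by split=> [/uw|->].
Qed.

Lemma qopK (Q : quandle) (x : Q) : cancel (qop x) (qldiv x).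
Proof. by move=> y; apply/esym/qldivP. Qed.

Lemma qldivK (Q : quandle) (x : Q) : cancel (qldiv x) (qop x).
Proof. by move=> y; apply/qldivP. Qed.

Definition isomorphic (Q R : quandle) : Prop :=
  exists h : Q -> R, bijective h /\ {morph h : x y / (x * y)%qdl >-> (x * y)%qdl}.

Record subquandle (Q : quandle) := Subquandle {
  sub_carrier :> set Q;
  sub_nonempty : sub_carrier !=set0;
  sub_op : forall x y, sub_carrier x -> sub_carrier y -> sub_carrier (x * y)%qdl;
  sub_ldiv : forall x y, sub_carrier x -> sub_carrier y -> sub_carrier (x \\ y)%qdl }.

Section SubquandleQuandle.
Variables (Q : quandle) (S : subquandle Q).
Implicit Types x y z : set_type S.

Definition subq_op x y : set_type S :=
  exist _ (val x * val y)%qdl (mem_set (sub_op (set_mem (valP x)) (set_mem (valP y)))).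

Lemma subq_nonempty : inhabited (set_type S).
Proof. by have [x Sx] := sub_nonempty S; exists; exists x; apply: mem_set. Qed.

Lemma subq_idem x : subq_op x x = x.
Proof. by apply: val_inj; rewrite /= qop_idem. Qed.

Lemma subq_unique_div x y : exists! z, subq_op x z = y.
Proof.
exists (exist _ (val x \\ val y)%qdl
  (mem_set (sub_ldiv (set_mem (valP x)) (set_mem (valP y))))).
split; first by apply: val_inj; rewrite /= qldivK.
by move=> z <-; apply: val_inj; rewrite /= qopK.
Qed.

Lemma subq_distr x y z :
  subq_op x (subq_op y z) = subq_op (subq_op x y) (subq_op x z).
Proof. by apply: val_inj; rewrite /= qop_distr. Qed.

Definition quandle_of_sub : quandle :=
  Quandle subq_nonempty subq_idem subq_unique_div subq_distr.

End SubquandleQuandle.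

Record automorphism (A : zmodType) := Automorphism {
  aut_fun :> {additive A -> A};
  aut_bij : bijective aut_fun }.

Section SemiregularExtension.
Variables (A : zmodType) (f : automorphism A).
Variables (I : Type) (I_nonempty : inhabited I) (d : I -> A).
Implicit Types p q r : (I * A)%type.

Definition ext_op p q : (I * A)%type :=
  (q.1, (p.2 - f p.2) + f q.2 + d p.1 - d q.1).

Lemma ext_nonempty : inhabited (I * A).
Proof. by case: I_nonempty => i; exists; exact: (i, 0). Qed.

Lemma ext_idem p : ext_op p p = p.
Proof. by case: p => i a; rewrite /ext_op /= subrK addrK. Qed.

Lemma ext_unique_div p q : exists! r, ext_op p r = q.
Proof.
have [g fK gK] := aut_bij f; case: p q => [i a] [j b].
exists (j, g (b + d j - d i - (a - f a))); split.
  by rewrite /ext_op /= gK addrC addrC [X in X + _ - _]addrC !subrK addrK.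
case=> k c; rewrite /ext_op /= => -[-> <-].
by rewrite subrK addrK addrAC subrr add0r fK.
Qed.

Lemma ext_distr p q r :
  ext_op p (ext_op q r) = ext_op (ext_op p q) (ext_op p r).
Proof.
case: p q r => [i a] [j b] [k c]; rewrite /ext_op /=; congr pair.
rewrite !(raddfD, raddfN) /= !(opprD, opprK, addrA).
rewrite [RHS](ACl (1*2*3*8*13*10*15*4*17*5*16*6*11*7*12*9*14))%AC /=.
by rewrite !(subrK, addrK).
Qed.

Definition Ext : quandle :=
  Quandle ext_nonempty ext_idem ext_unique_div ext_distr.

Definition fiber (i : I) : set Ext := [set p | p.1 = i].

End SemiregularExtension.

Section AffineQuandle.
Variables (A : zmodType) (f : automorphism A).
Implicit Types a b c : A.

Definition aff_op a b : A := (a - f a) + f b.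

Lemma aff_nonempty : inhabited A.
Proof. by exists; exact: 0. Qed.

Lemma aff_idem a : aff_op a a = a.
Proof. exact: subrK. Qed.

Lemma aff_unique_div a b : exists! c, aff_op a c = b.
Proof.
have [g fK gK] := aut_bij f; exists (g (b - (a - f a))); split.
  by rewrite /aff_op gK addrC subrK.
by move=> c <-; rewrite /aff_op addrAC subrr add0r fK.
Qed.

Lemma aff_distr a b c : aff_op a (aff_op b c) = aff_op (aff_op a b) (aff_op a c).
Proof.
rewrite /aff_op !(raddfD, raddfN) /= !(opprD, opprK, addrA).
rewrite [RHS](ACl (1*2*3*6*9*4*7*5*8))%AC /=.
by rewrite !(subrK, addrK).
Qed.

Definition Aff : quandle :=
  Quandle aff_nonempty aff_idem aff_unique_div aff_distr.

End AffineQuandle.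

Definition affine (Q : quandle) : Prop :=
  exists (A : zmodType) (f : automorphism A), isomorphic Q (Aff f).

Definition quasi_affine (Q : quandle) : Prop :=
  exists (R : quandle) (S : subquandle R), affine R /\ isomorphic Q (quandle_of_sub S).

Section PermutationGroups.
Variable X : Type.
Implicit Types (G : set (X -> X)) (g h : X -> X).

Definition perm_group G : Prop :=
  [/\ G id,
      forall g h, G g -> G h -> G (g \o h) &
      forall g, G g -> exists2 g', G g' & cancel g g' /\ cancel g' g].

Definition abelian_perm G : Prop := forall g h, G g -> G h -> g \o h = h \o g.

Definition semiregular G : Prop := forall g, G g -> g <> id -> forall x, g x <> x.

Definition orbit G (x : X) : set X := [set g x | g in G].

End PermutationGroups.

(* The inverse of the left translation [qop b] is [qldiv b]. *)
Definition Dis (Q : quandle) : set (Q -> Q) :=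
  smallest (@perm_group Q) [set g | exists a b : Q, g = qop a \o qldiv b].

Arguments Dis : clear implicits.

Lemma Dis_perm_group (Q : quandle) : perm_group (Dis Q).
Proof.
split=> [G [[G1 _ _] _] //|g h Dg Dh G GS|g Dg].
  by have [[_ GM _] _] := GS; apply: GM; [apply: Dg|apply: Dh].
pose B : set (Q -> Q) := [set h | bijective h].
have BS : perm_group B /\ [set g | exists a b : Q, g = qop a \o qldiv b] `<=` B.
  split; last first.
    move=> _ [a [b ->]]; exists (qop b \o qldiv a) => x /=;
      by rewrite ?(qopK, qldivK).
  split=> [|h k Bh Bk|h [k hK kK]].
  - by exists id.
  - exact: bij_comp.
  - by exists k; [exists h|].
have [g' gK g'K] : bijective g := Dg B BS.
exists g'; last by split.
move=> G GS; have [[_ _ GV] _] := GS.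
have [k Gk [gk kg]] := GV g (Dg G GS).
suff -> : g' = k by [].
by apply/funext=> x; rewrite -{1}(kg x) gK.
Qed.

Definition orbits (Q : quandle) : set (set Q) := range (orbit (Dis Q)).

Arguments orbits : clear implicits.

Definition indecomposable (A : zmodType) (f : automorphism A) (I : Type)
    (I_nonempty : inhabited I) (d : I -> A) : Prop :=
  orbits (Ext f I_nonempty d) = range (fiber (d := d)).

Inductive term (n : nat) :=
  | Var of 'I_n
  | Op of term n & term n
  | Ldiv of term n & term n.

Fixpoint term_op (Q : quandle) (n : nat) (t : term n) (e : n.-tuple Q) : Q :=
  match t with
  | Var i => tnth e i
  | Op t1 t2 => (term_op t1 e * term_op t2 e)%qdl
  | Ldiv t1 t2 => (term_op t1 e \\ term_op t2 e)%qdl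
  end.

Definition abelian_quandle (Q : quandle) : Prop :=
  forall (k : nat) (t : term k.+1) (a b : Q) (u v : k.-tuple Q),
    term_op t [tuple of a :: u] = term_op t [tuple of a :: v] ->
    term_op t [tuple of b :: u] = term_op t [tuple of b :: v].

(* Main.v *)
From HB Require Import structures.
Require Import Defs.
From mathcomp Require Import all_boot all_order all_algebra.
From mathcomp Require Import boolp classical_sets functions.

(** In an affine quandle each generator L_a L_b^-1 of the displacement group is
the translation by (1-f)(a-b). Hence on a subquandle of an affine quandle every
displacement is the restriction of a translation ([Dis_translation]);
translations commute, and one with a fixed point is the identity. So Dis(Q) is
abelian and semiregular.

Conversely, let Dis(Q) be abelian and semiregular. Choose a base point e and a
point r_i in each orbit i. Semiregularity makes (i, g) |-> g(r_i) a bijection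
from pairs (orbit, displacement) to Q. Take A = Dis(Q), written additively, let
f be the conjugation by L_e, and put d_i = L_{r_i} L_e^-1, an element of
Dis(Q). The bijection is then an isomorphism from Ext(A, f, d)
([dis_act_morph]). It carries the fibers to the orbits, so this extension is
indecomposable.

In Ext(A, f, d) the index of the value of a term is the index of one fixed
variable, and its A-component is a sum of functions of one variable each.
Hence the change of value caused by replacing the parameters u by v does not
depend on the remaining argument ([Ext_term_snd]), and the term condition
follows.

Under the term condition, write a displacement as a word in the L_a L_b^-1.
When all letters of the word are made equal, it becomes the identity. If the
word fixes x, it therefore agrees at x with a constant word; by the term
condition they agree everywhere, so the word is the identity. Applied to the
term w(z) * (w(b) \\ y) in the variable z, the same comparison gives
g L_a L_b^-1 g^-1 = L_a L_b^-1 for every displacement g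
([abelian_word_gen]). So Dis(Q) is abelian and semiregular.

What remains is to embed Ext(A, f, d) in an affine quandle. Replace A by A * A
with the automorphism (a, u) |-> (f(a) - u, u) and send (i, a) to (a, d_i): the
off-diagonal part of the automorphism produces the terms d_i - d_j. A third
coordinate, on which the automorphism is trivial, separates indices that have
the same d_i. *)

Set Implicit Arguments.
Unset Strict Implicit.
Unset Printing Implicit Defensive.

Import GRing.Theory.

Local Open Scope classical_set_scope.
Local Open Scope ring_scope.

Local Notation orbit := Defs.orbit.

(** * Isomorphisms and embeddings of quandles *)

Section Morphisms.
Variables (Q R : quandle) (h : Q -> R).
Hypothesis hM : {morph h : x y / (x * y)%qdl}.

Lemma qldiv_morph : {morph h : x y / (x \\ y)%qdl}.
Proof. by move=> x y; apply/qldivP; rewrite -hM qldivK. Qed.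

Definition image_subquandle : subquandle R.
Proof.
exists (range h).
- by have [x] := quandle_nonempty Q; exists (h x); exists x.
- by move=> _ _ [x _ <-] [y _ <-]; exists (x * y)%qdl.
- by move=> _ _ [x _ <-] [y _ <-]; exists (x \\ y)%qdl => //; exact: qldiv_morph.
Defined.

Lemma can_qop_morph (k : R -> Q) :
  cancel h k -> cancel k h -> {morph k : x y / (x * y)%qdl}.
Proof. by move=> hK kK x y; rewrite -{1}(kK x) -{1}(kK y) -hM hK. Qed.

Lemma isomorphic_of_inj_surj :
  injective h -> (forall y, exists x, h x = y) -> isomorphic Q R.
Proof.
move=> h_inj h_surj; exists h; split=> //.
have [k kK] := choice h_surj.
by exists k => // x; apply: h_inj; rewrite kK.
Qed.

End Morphisms.

Lemma isomorphic_sym (Q R : quandle) : isomorphic Q R -> isomorphic R Q.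
Proof.
case=> h [[k hK kK] hM]; exists k; split; first by exists h.
exact: can_qop_morph hM _ hK kK.
Qed.

Lemma qop_morph (Q : quandle) (a : Q) : {morph qop a : x y / (x * y)%qdl}.
Proof. by move=> x y; rewrite qop_distr. Qed.

Lemma quasi_affineP (Q : quandle) :
  quasi_affine Q <->
  exists (A : zmodType) (f : automorphism A) (h : Q -> Aff f),
    injective h /\ {morph h : x y / (x * y)%qdl}.
Proof.
split.
  case=> R [S [[A [f [k [kbij kM]]]] [h [hbij hM]]]].
  exists A, f, (k \o val \o h); split.
    exact: inj_comp (inj_comp (bij_inj kbij) val_inj) (bij_inj hbij).
  by move=> x y /=; rewrite hM kM.
case=> A [f [h [h_inj hM]]].
exists (Aff f), (image_subquandle hM); split.
  by exists A, f, id; split=> //; exists id.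
pose k x : quandle_of_sub (image_subquandle hM) :=
  exist _ (h x) (mem_set (imageT h x)).
apply: (@isomorphic_of_inj_surj _ _ k).
- by move=> x y; apply: val_inj; rewrite /= hM.
- by move=> x y /(congr1 val) /h_inj.
- by move=> [y Sy]; have [x _ xy] := set_mem Sy; exists x; apply: val_inj.
Qed.

(** * The displacement group *)

Section Displacements.
Variable Q : quandle.
Implicit Types g : Q -> Q.

Lemma Dis_gen (a b : Q) : Dis Q (qop a \o qldiv b).
Proof. by move=> G [_]; apply; exists a, b. Qed.

Lemma Dis_id : Dis Q id. Proof. by case: (Dis_perm_group Q). Qed.

Lemma Dis_comp g h : Dis Q g -> Dis Q h -> Dis Q (g \o h).
Proof. by case: (Dis_perm_group Q) => _ + _; apply. Qed.

Lemma Dis_inv g : Dis Q g -> exists2 g', Dis Q g' & cancel g g' /\ cancel g' g.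
Proof. by case: (Dis_perm_group Q) => _ _; apply. Qed.

(** The inverse of a displacement is given only through the two cancellation
laws, so the last clause takes it in that form. *)
Lemma Dis_ind (P : (Q -> Q) -> Prop) :
  (forall a b, P (qop a \o qldiv b)) -> P id ->
  (forall g h, P g -> P h -> P (g \o h)) ->
  (forall g g', P g -> cancel g g' -> cancel g' g -> P g') ->
  forall g, Dis Q g -> P g.
Proof.
move=> Pgen P1 PM PV g /(_ [set g | bijective g /\ P g]) []//.
split; last first.
  move=> _ [a [b ->]]; split=> //; exists (qop b \o qldiv a) => x /=;
    by rewrite ?(qopK, qldivK).
split=> [|{}g h [bg Pg] [bh Ph]|{}g [[g' gK g'K] Pg]].
- by split=> //; exists id.
- by split; [exact: bij_comp|exact: PM].
- by exists g'; split=> //; [exists g|exact: PV gK g'K].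
Qed.

Lemma Dis_morph g : Dis Q g -> {morph g : x y / (x * y)%qdl}.
Proof.
move: g; apply: Dis_ind => // [a b x y|g h gM hM x y|g g' gM gK g'K] /=.
- rewrite (can_qop_morph (@qop_morph _ b) (@qopK _ b) (@qldivK _ b)).
  exact: qop_morph.
- by rewrite hM gM.
- exact: can_qop_morph gM _ gK g'K.
Qed.

Lemma Dis_fix_id g (x : Q) : semiregular (Dis Q) -> Dis Q g -> g x = x -> g = id.
Proof. by move=> sr Dg gx; apply: contrapT => /(sr _ Dg)/(_ x). Qed.

(** Under semiregularity a displacement is determined by its value at one
point: g^-1 h has a fixed point. *)
Lemma Dis_eq g h (x : Q) :
  semiregular (Dis Q) -> Dis Q g -> Dis Q h -> g x = h x -> g = h.
Proof.
move=> sr Dg Dh gh; have [h' Dh' [hK h'K]] := Dis_inv Dh.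
have E : h' \o g = id by apply: (@Dis_fix_id _ x) => //; [exact: Dis_comp|rewrite /= gh hK].
by apply/funext=> y; rewrite -(h'K (g y)) -[h' (g y)]/((h' \o g) y) E.
Qed.

Lemma orbit_refl (x : Q) : orbit (Dis Q) x x.
Proof. by exists id => //; exact: Dis_id. Qed.

Lemma orbit_Dis g x : Dis Q g -> orbit (Dis Q) (g x) = orbit (Dis Q) x.
Proof.
move=> Dg; have [g' Dg' [gK g'K]] := Dis_inv Dg; apply/seteqP; split=> _ [h Dh <-].
  by exists (h \o g) => //; exact: Dis_comp.
by exists (h \o g'); [exact: Dis_comp|rewrite /= gK].
Qed.

End Displacements.

(** Applied with Q = R and a left translation, this gives stability of the
displacement group under conjugation by left translations; applied to an
isomorphism it transports displacements. *)
Lemma Dis_conj (Q R : quandle) (h : Q -> R) (k : R -> Q) g :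
  {morph h : x y / (x * y)%qdl} -> cancel h k -> cancel k h ->
  Dis Q g -> Dis R (h \o g \o k).
Proof.
move=> hM hK kK; move: g; apply: Dis_ind => [a b||g1 g2 D1 D2|g g' Dg gK g'K].
- rewrite (_ : _ \o _ = qop (h a) \o qldiv (h b)); first exact: Dis_gen.
  by apply/funext=> x /=; rewrite hM (qldiv_morph hM) kK.
- by rewrite (_ : _ \o _ = id); [exact: Dis_id|exact/funext].
- rewrite (_ : _ \o _ = (h \o g1 \o k) \o (h \o g2 \o k)); first exact: Dis_comp.
  by apply/funext=> x /=; rewrite hK.
- have [r Dr [rK Kr]] := Dis_inv Dg.
  rewrite (_ : _ \o _ = r) //; apply/funext=> x.
  by rewrite -{1}(Kr x) /= hK gK kK.
Qed.

Lemma orbit_isomorphism (Q R : quandle) (h : Q -> R) (k : R -> Q) x :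
  {morph h : x y / (x * y)%qdl} -> cancel h k -> cancel k h ->
  orbit (Dis R) (h x) = h @` orbit (Dis Q) x.
Proof.
move=> hM hK kK; have kM := can_qop_morph hM hK kK.
apply/seteqP; split=> [_ [g Dg <-]|_ [_ [g Dg <-] <-]].
  by exists (k (g (h x))) => //; exists (k \o g \o h) => //; exact: Dis_conj kM kK hK Dg.
by exists (h \o g \o k) => //=; [exact: Dis_conj hM hK kK Dg|rewrite hK].
Qed.

(** * Quasi-affine quandles *)

(** The translations pull back along the embedding to a permutation group that
contains the generators L_a L_b^-1, hence all displacements. *)
Lemma Dis_translation (Q : quandle) (A : zmodType) (f : automorphism A)
    (h : Q -> Aff f) : {morph h : x y / (x * y)%qdl} ->
  forall g, Dis Q g -> exists c : A, forall x, h (g x) = (h x : A) + c.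
Proof.
move=> hM; apply: Dis_ind => [a b||g1 g2 [c Ec] [d Ed]|g g' [c Ec] gK g'K].
- exists ((h a : A) - f (h a) - ((h b : A) - f (h b))) => x /=.
  have : h x = (h b * h (b \\ x))%qdl by rewrite -hM qldivK.
  rewrite hM /= /aff_op => ->.
  by rewrite [RHS]addrC addrA subrK.
- by exists 0 => x; rewrite addr0.
- by exists (d + c) => x /=; rewrite Ec Ed addrA.
- by exists (- c) => x; rewrite -{2}(g'K x) Ec addrK.
Qed.

Lemma quasi_affine_Dis (Q : quandle) :
  quasi_affine Q -> abelian_perm (Dis Q) /\ semiregular (Dis Q).
Proof.
case/quasi_affineP=> A [f [h [h_inj hM]]]; have tr := Dis_translation hM; split.
  move=> g1 g2 /tr[c Ec] /tr[d Ed]; apply/funext=> x; apply: h_inj => /=.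
  by rewrite !(Ec, Ed) addrAC.
move=> g /tr[c Ec] g_neq1 x gx; apply: g_neq1; apply/funext=> y; apply: h_inj.
have := Ec x; rewrite gx Ec -[X in X = _ -> _](addr0 (h x : A)) => /addrI <-.
by rewrite addr0.
Qed.

(** * A semiregular extension from an abelian semiregular displacement group *)

Section DisplacementGroup.
Variables (Q : quandle) (Dis_abelian : abelian_perm (Dis Q)).

(** The proof of commutativity is a parameter of the type so that the instance
of an abelian group below can depend on it. *)
Definition dis_group of abelian_perm (Dis Q) : Type := set_type (Dis Q).
Local Notation D := (dis_group Dis_abelian).

Definition dis_elt (g : D) : Q -> Q := val g.

Definition to_dis g (Dg : Dis Q g) : D := exist _ g (mem_set Dg).

Lemma dis_eltP (g : D) : Dis Q (dis_elt g). Proof. exact: set_mem (valP g). Qed.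

Lemma dis_elt_inj : injective dis_elt. Proof. exact: val_inj. Qed.

Lemma dis_opp_subproof (g : D) :
  exists h : D, cancel (dis_elt g) (dis_elt h) /\ cancel (dis_elt h) (dis_elt g).
Proof.
by have [h Dh gh] := Dis_inv (dis_eltP g); exists (to_dis Dh).
Qed.

Definition dis_opp (g : D) : D := projT1 (cid (dis_opp_subproof g)).
Definition dis_add (g h : D) : D := to_dis (Dis_comp (dis_eltP g) (dis_eltP h)).
Definition dis_zero : D := to_dis (@Dis_id Q).

Lemma dis_addA : associative dis_add.
Proof. by move=> g h k; exact: dis_elt_inj. Qed.

Lemma dis_addC : commutative dis_add.
Proof. by move=> g h; apply/dis_elt_inj/Dis_abelian; exact: dis_eltP. Qed.

Lemma dis_add0 : left_id dis_zero dis_add.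
Proof. by move=> g; exact: dis_elt_inj. Qed.

Lemma dis_addN : left_inverse dis_zero dis_opp dis_add.
Proof.
move=> g; rewrite /dis_opp; case: cid => h /= [gK hK].
by apply/dis_elt_inj/funext=> x; exact: gK.
Qed.

HB.instance Definition _ := gen_eqMixin D.
HB.instance Definition _ := gen_choiceMixin D.
HB.instance Definition _ :=
  GRing.isZmodule.Build D dis_addA dis_addC dis_add0 dis_addN.

Variable e : Q.

Definition dis_conj (g : D) : D :=
  to_dis (Dis_conj (@qop_morph Q e) (@qopK Q e) (@qldivK Q e) (dis_eltP g)).

Lemma dis_eltD (g h : D) x : dis_elt (g + h) x = dis_elt g (dis_elt h x).
Proof. by []. Qed.

Lemma dis_eltK (g : D) : cancel (dis_elt g) (dis_elt (- g)).
Proof. by move=> x; rewrite -dis_eltD addNr. Qed.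

Lemma dis_conjE (g : D) x : dis_elt (dis_conj g) x = (e * dis_elt g (e \\ x))%qdl.
Proof. by []. Qed.

Lemma dis_conj_nmod_morphism : nmod_morphism dis_conj.
Proof.
split=> [|g h]; apply/dis_elt_inj/funext=> x.
  by rewrite dis_conjE [dis_elt 0 _]/= qldivK.
by rewrite dis_eltD !dis_conjE dis_eltD qopK.
Qed.

HB.instance Definition _ :=
  GRing.isNmodMorphism.Build D D dis_conj dis_conj_nmod_morphism.

Lemma dis_conj_bij : bijective dis_conj.
Proof.
have ldivM := can_qop_morph (@qop_morph _ e) (@qopK _ e) (@qldivK _ e).
pose k (g : D) : D :=
  to_dis (Dis_conj ldivM (@qldivK Q e) (@qopK Q e) (dis_eltP g)).
by exists k => g; apply/dis_elt_inj/funext=> x; rewrite /dis_elt/= ?(qopK, qldivK).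
Qed.

Definition dis_aut : automorphism D := Automorphism dis_conj_bij.

Definition orbit_rep (i : set_type (orbits Q)) : Q :=
  projT1 (cid2 (set_mem (valP i))).

Lemma orbit_repP i : orbit (Dis Q) (orbit_rep i) = val i.
Proof. by rewrite /orbit_rep; case: cid2. Qed.

Lemma orbits_inhabited : inhabited (set_type (orbits Q)).
Proof. by exists; exists (orbit (Dis Q) e); apply: mem_set; exists e. Qed.

Definition dis_shift (i : set_type (orbits Q)) : D :=
  to_dis (Dis_gen (orbit_rep i) e).

Local Notation E := (Ext dis_aut orbits_inhabited dis_shift).

Definition dis_act (p : E) : Q := dis_elt p.2 (orbit_rep p.1).

(** With g and h in Dis(Q), L_{g(r_i)} = g L_{r_i} g^-1 = g d_i L_e g^-1, and
L_e(r_j) = L_e L_{r_j}^-1 (r_j) = d_j^-1(r_j). Hence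
g(r_i) * h(r_j) = g d_i L_e g^-1 h (r_j) = g d_i f(g^-1 h) d_j^-1 (r_j), which
is the product in the extension, written multiplicatively. *)
Lemma dis_act_morph : {morph dis_act : p q / (p * q)%qdl}.
Proof.
move=> [i g] [j h]; rewrite /dis_act /= /ext_op /=.
have -> : g - dis_conj g + dis_conj h + dis_shift i - dis_shift j
   = g + dis_shift i + dis_conj (- g + h) - dis_shift j.
  by rewrite raddfD raddfN /= !addrA [RHS](ACl (1*3*4*2*5))%AC.
rewrite !dis_eltD.
have -> : dis_elt (- dis_shift j) (orbit_rep j) = (e * orbit_rep j)%qdl.
  rewrite -[RHS](dis_eltK (dis_shift j)); congr dis_elt.
  by rewrite /dis_elt /= qopK qop_idem.
rewrite {2 3}/dis_elt /= qopK qopK [_ (orbit_rep j)]dis_eltD.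
rewrite (Dis_morph (dis_eltP g)) -dis_eltD subrr //.
Qed.

Lemma dis_act_inj : semiregular (Dis Q) -> injective dis_act.
Proof.
move=> sr [i g] [j h]; rewrite /dis_act /= => gh.
have ij : i = j.
  apply: val_inj; rewrite -!orbit_repP -(orbit_Dis _ (dis_eltP g)) gh.
  by rewrite (orbit_Dis _ (dis_eltP h)).
rewrite -{j}ij in gh *; congr pair.
exact/dis_elt_inj/(Dis_eq sr (dis_eltP g) (dis_eltP h) gh).
Qed.

Lemma dis_act_surj x : exists p, dis_act p = x.
Proof.
pose i : set_type (orbits Q) := exist _ (orbit (Dis Q) x) (mem_set (imageT _ x)).
have [g Dg gx] : orbit (Dis Q) (orbit_rep i) x.
  by rewrite orbit_repP; exact: orbit_refl.
by exists (i, to_dis Dg).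
Qed.

Lemma dis_act_fiber p : [set dis_act q | q in fiber (d := dis_shift) p.1] =
   orbit (Dis Q) (dis_act p).
Proof.
rewrite (orbit_Dis _ (dis_eltP _)); apply/seteqP.
split=> [_ [q qp <-]|_ [g Dg <-]].
  have <- : q.1 = p.1 := qp.
  by exists (dis_elt q.2) => //; exact: dis_eltP.
by exists (p.1, to_dis Dg).
Qed.

End DisplacementGroup.

Lemma semiregular_Ext (Q : quandle) :
  abelian_perm (Dis Q) -> semiregular (Dis Q) ->
  exists (A : zmodType) (f : automorphism A) (I : Type)
         (I_nonempty : inhabited I) (d : I -> A),
         isomorphic Q (Ext f I_nonempty d) /\ indecomposable f I_nonempty d.
Proof.
move=> ab sr; have [e] := quandle_nonempty Q.
exists _, (dis_aut ab e), _, (orbits_inhabited e), (@dis_shift Q ab e).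
set h := @dis_act Q ab e; have hM : {morph h : x y / _} := @dis_act_morph Q ab e.
have h_inj : injective h := dis_act_inj sr.
have h_surj : forall x, exists p, h p = x := @dis_act_surj Q ab e.
split; first exact/isomorphic_sym/(isomorphic_of_inj_surj hM).
have [k kK] := choice h_surj.
have hK : cancel h k by move=> p; apply: h_inj; rewrite kK.
pose E := Ext (dis_aut ab e) (orbits_inhabited e) (dis_shift ab e).
have orbE (p : E) : orbit (Dis E) p = fiber (d := dis_shift ab e) p.1.
  apply/funext=> q; rewrite -!(image_inj h_inj) dis_act_fiber.
  by rewrite (orbit_isomorphism _ hM hK kK).
apply/seteqP; split=> [_ [p _ <-]|_ [i _ <-]]; first by exists p.1; rewrite ?orbE.
by exists (i, 0); rewrite ?orbE.
Qed.

(** * The term condition in semiregular extensions *)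

Section TermCondition.
Variables (Q R : quandle) (h : Q -> R).
Hypotheses (h_inj : injective h) (hM : {morph h : x y / (x * y)%qdl}).

Lemma term_op_morph n (t : term n) (e : n.-tuple Q) :
  h (term_op t e) = term_op t (map_tuple h e).
Proof.
elim: t => /= [i|t1 IH1 t2 IH2|t1 IH1 t2 IH2]; first by rewrite tnth_map.
  by rewrite hM IH1 IH2.
by rewrite (qldiv_morph hM) IH1 IH2.
Qed.

Lemma abelian_quandle_sub : abelian_quandle R -> abelian_quandle Q.
Proof.
move=> abR k t a b u v /(congr1 h) uv; apply: h_inj; move: uv.
have consE c (w : k.-tuple Q) :
    map_tuple h [tuple of c :: w] = [tuple of h c :: map_tuple h w].
  exact: val_inj.
by rewrite !term_op_morph !consE; exact: abR.
Qed.

End TermCondition.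

Section SeparatedTerms.
Variables (X : Type) (A : zmodType) (k : nat).
Implicit Types G H : k.+1.-tuple X -> A.

(** This holds when G is the sum of a function of the first variable and a
function of the others; stated through differences, it needs no choice of
summands. *)
Definition separated G : Prop := forall a b (u v : k.-tuple X),
  G [tuple of a :: u] - G [tuple of a :: v] =
  G [tuple of b :: u] - G [tuple of b :: v].

Lemma separatedD G H : separated G -> separated H -> separated (G \+ H).
Proof.
move=> sG sH a b u v; rewrite /= !opprD.
by rewrite addrACA [RHS]addrACA (sG a b) (sH a b).
Qed.

Lemma separated_additive (f : {additive A -> A}) G :
  separated G -> separated (f \o G).
Proof. by move=> sG a b u v; rewrite /= -!raddfB (sG a b). Qed.

(** The division of an extension involves f^-1; with this lemma it suffices to
consider its image under f. *)
Lemma separated_additive_inj (f : {additive A -> A}) G :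
  injective f -> separated (f \o G) -> separated G.
Proof.
by move=> f_inj sG a b u v; apply: f_inj; rewrite !raddfB; exact: sG.
Qed.

Lemma separatedN G : separated G -> separated (fun e => - G e).
Proof. by move=> sG a b u v; rewrite -!opprD (sG a b). Qed.

Lemma separated_coord (phi : X -> A) i : separated (fun e => phi (tnth e i)).
Proof.
move=> a b u v; case: (unliftP ord0 i) => [j|] ->; rewrite ?tnthS //.
by rewrite !tnth0 !subrr.
Qed.

End SeparatedTerms.

Section ExtTermCondition.
Variables (A : zmodType) (f : automorphism A) (I : Type) (I0 : inhabited I).
Variable d : I -> A.
Local Notation E := (Ext f I0 d).

Lemma Ext_ldiv_fst (p q : E) : (p \\ q)%qdl.1 = q.1.
Proof. by rewrite -{2}(qldivK p q). Qed.

Lemma Ext_ldiv_snd (p q : E) :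
  f (p \\ q)%qdl.2 = q.2 - p.2 + f p.2 - d p.1 + d q.1.
Proof.
have defq : p.2 - f p.2 + f (p \\ q)%qdl.2 + d p.1 - d q.1 = q.2.
  by rewrite -(Ext_ldiv_fst p q) -[in RHS](qldivK p q).
rewrite -[X in X - p.2]defq [RHS](ACl (3*1*6*2*7*4*8*5*9))%AC /=.
by rewrite !(addrK, subrK).
Qed.

(** Both operations keep the index of their right argument, so the index is that
of the rightmost variable of the term. *)
Lemma Ext_term_fst n (t : term n) :
  exists i, forall e : n.-tuple E, (term_op t e).1 = (tnth e i).1.
Proof.
elim: t => /= [i|t1 _ t2 [i Ei]|t1 _ t2 [i Ei]]; first by exists i.
  by exists i.
by exists i => e; rewrite Ext_ldiv_fst.
Qed.

(** Each operation combines the A-components of its arguments by additive maps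
and adds values of d at indices, which depend on one variable only. *)
Lemma Ext_term_snd k (t : term k.+1) :
  separated (fun e : k.+1.-tuple E => (term_op t e).2).
Proof.
have sd (t' : term k.+1) :
    separated (fun e : k.+1.-tuple E => d (term_op t' e).1).
  have [i Ei] := Ext_term_fst t'.
  rewrite (_ : (fun _ => _) = fun e => (d \o fst) (tnth e i)).
    exact: separated_coord.
  by apply/funext=> e; rewrite Ei.
elim: t => /= [i|t1 IH1 t2 IH2|t1 IH1 t2 IH2].
- exact: (@separated_coord _ _ _ snd).
- do ?[exact: IH1|exact: IH2|exact: sd|apply: separatedN|
       apply: separated_additive|apply: separatedD].
- apply: (separated_additive_inj (bij_inj (aut_bij f))).
  rewrite (_ : _ \o _ = fun e : k.+1.-tuple E => (term_op t2 e).2 - (term_op t1 e).2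
    + f (term_op t1 e).2 - d (term_op t1 e).1 + d (term_op t2 e).1).
    do ?[exact: IH1|exact: IH2|exact: sd|apply: separatedN|
       apply: separated_additive|apply: separatedD].
  by apply/funext=> e; rewrite /= Ext_ldiv_snd.
Qed.

Lemma Ext_abelian : abelian_quandle E.
Proof.
move=> k t a b u v uv.
have [i Ei] := Ext_term_fst t.
apply: injective_projections.
  have /(congr1 fst) := uv; rewrite !Ei.
  by case: (unliftP ord0 i) => [j|] ->; rewrite ?tnthS // !tnth0.
apply/eqP; rewrite -subr_eq0 -(Ext_term_snd t a b) uv subrr //.
Qed.

End ExtTermCondition.

(** * Embedding a semiregular extension in an affine quandle *)

Section ExtEmbedding.
Variables (A : zmodType) (f : automorphism A) (I : Type) (I0 : inhabited I).
Variable d : I -> A.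
Local Notation B := (A * A * (I -> int))%type.

(** For this automorphism g the map 1-g sends (a, u, w) to
((1-f)(a) + u, 0, 0), so a second coordinate u = d_i adds d_i to the product,
while g itself subtracts the d_j of the right argument. *)
Definition shear (b : B) : B := (f b.1.1 - b.1.2, b.1.2, b.2).

Lemma shear_nmod_morphism : nmod_morphism shear.
Proof.
split=> [|[[a u] w] [[a' u'] w']]; rewrite /shear /=; first by rewrite raddf0 subr0.
by rewrite raddfD opprD addrACA.
Qed.

HB.instance Definition _ := GRing.isNmodMorphism.Build B B shear shear_nmod_morphism.

Lemma shear_bij : bijective shear.
Proof.
have [g fK gK] := aut_bij f.
exists (fun b : B => (g (b.1.1 + b.1.2), b.1.2, b.2)) => -[[a u] w];
  by rewrite /shear /= ?subrK ?fK // gK addrK.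
Qed.

Definition shear_aut : automorphism B := Automorphism shear_bij.

Definition Ext_to_Aff (p : Ext f I0 d) : Aff shear_aut :=
  (p.2, d p.1, fun j => (`[< j = p.1 >])%:R).

Lemma Ext_to_Aff_inj : injective Ext_to_Aff.
Proof.
move=> [i a] [j b] [-> _ /(congr1 (fun w => w i))].
by rewrite asboolT //; case: asboolP => [->|].
Qed.

Lemma Ext_to_Aff_morph : {morph Ext_to_Aff : p q / (p * q)%qdl}.
Proof.
move=> [i a] [j b]; pose w k : I -> int := fun l => (`[< l = k >])%:R.
rewrite -[RHS]/(a - (f a - d i) + (f b - d j), d i - d i + d j, w i - w i + w j).
rewrite !subrr !add0r opprB !addrA.
by rewrite [in RHS](ACl (1*3*4*2*5))%AC.
Qed.

End ExtEmbedding.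

(** * The term condition for words in displacements *)

Section Words.
Variable Q : quandle.
Implicit Types (w : seq (Q * Q)) (x y a b : Q).

(** A pair (a, b) stands for L_a L_b^-1. Since swapping a pair inverts it, the
words represent every displacement. *)
Definition word w y : Q := foldr (fun p z => p.1 * (p.2 \\ z))%qdl y w.

Lemma word_cat w1 w2 y : word (w1 ++ w2) y = word w1 (word w2 y).
Proof. exact: foldr_cat. Qed.

Lemma word_diag (T : Type) (s : seq T) a y : word [seq (a, a) | _ <- s] y = y.
Proof. by elim: s => //= _ s ->; rewrite qldivK. Qed.

Lemma word_revK w y : word (rev [seq (p.2, p.1) | p <- w]) (word w y) = y.
Proof.
elim: w y => //= -[a b] w IH y.
by rewrite rev_cons -cats1 word_cat /= qopK qldivK IH.
Qed.

Lemma Dis_word g : Dis Q g -> exists w, g = word w.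
Proof.
move: g; apply: Dis_ind => [a b||_ _ [w1 ->] [w2 ->]|_ g' [w ->] _ g'K].
- by exists [:: (a, b)].
- by exists [::].
- by exists (w1 ++ w2); apply/funext=> y; rewrite word_cat.
- exists (rev [seq (p.2, p.1) | p <- w]); apply/funext=> y.
  by rewrite -[in RHS](g'K y) word_revK.
Qed.

Definition letter w (p : 'I_(size w) * bool) : Q :=
  let q := tnth (in_tuple w) p.1 in if p.2 then q.1 else q.2.

Definition pair_up n (u : 'I_n * bool -> Q) : seq (Q * Q) :=
  [seq (u (i, true), u (i, false)) | i <- enum 'I_n].

Lemma pair_up_letter w : pair_up (@letter w) = w.
Proof.
rewrite -[RHS](map_tnth_enum (in_tuple w)); apply: eq_map => i.
exact/esym/surjective_pairing.
Qed.

(** The term whose value is a word applied to the value of t; the map s says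
which variable stands for each letter. *)
Definition word_term n N (s : 'I_n * bool -> 'I_N) (t : term N) : term N :=
  foldr (fun i t' => Op (Var (s (i, true))) (Ldiv (Var (s (i, false))) t'))
        t (enum 'I_n).

Lemma word_termE n N (s : 'I_n * bool -> 'I_N) t (e : N.-tuple Q) :
  term_op (word_term s t) e = word (pair_up (tnth e \o s)) (term_op t e).
Proof. by rewrite /word_term /pair_up; elim: (enum _) => //= i r ->. Qed.

(** Naming the parameters by a finite type J avoids arithmetic on positions in
a tuple; position 0 is reserved for the distinguished variable. *)
Section Environments.
Variable J : finType.

Definition env (a : Q) (u : J -> Q) : #|J|.+1.-tuple Q :=
  [tuple of a :: [tuple u (enum_val i) | i < #|J|]].

Definition pvar (j : J) : 'I_#|J|.+1 := lift ord0 (enum_rank j).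

Lemma env0 a u : tnth (env a u) ord0 = a. Proof. exact: tnth0. Qed.

Lemma env_pvar a u j : tnth (env a u) (pvar j) = u j.
Proof. by rewrite tnthS tnth_mktuple enum_rankK. Qed.

End Environments.

Hypothesis Q_abelian : abelian_quandle Q.

(** If the word w fixes x, then the words with letters w and with all letters
equal to x take the same value at x, hence at every y, where the second one
takes the value y. *)
Lemma abelian_semiregular : semiregular (Dis Q).
Proof.
move=> g /Dis_word[w ->] w_neq1 x wx; apply: w_neq1; apply/funext=> y.
pose t := word_term (@pvar _) (Var ord0) : term #|{: 'I_(size w) * bool}|.+1.
have tE a u : term_op t (env a u) = word (pair_up u) a.
  rewrite word_termE /= env0; congr word; apply: eq_map => i.
  by rewrite /= !env_pvar.
have := @Q_abelian _ t x y [tuple letter (enum_val i) | i < _] [tuple x | i < _].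
rewrite -/(env x _) -/(env y _) -/(env x (fun=> x)) -/(env y (fun=> x)) !tE.
by rewrite pair_up_letter /pair_up !word_diag; exact.
Qed.

(** In w(z) * (w(b) \\ y) the choice z = b gives y whatever the letters of w are.
By the term condition, at z = a these letters can be replaced by constant ones,
which turns w into the identity. *)
Lemma abelian_word_gen w a b y :
  (word w a * (word w b \\ y) = a * (b \\ y))%qdl.
Proof.
pose J : finType := (bool + 'I_(size w) * bool)%type.
pose W := word_term (fun p => pvar (inr p : J)).
pose t : term #|J|.+1 :=
  Op (W (Var ord0)) (Ldiv (W (Var (pvar (inl true)))) (Var (pvar (inl false)))).
pose u c (j : J) : Q :=
  match j with inl true => b | inl false => y | inr p => c p end.
have tE x c : term_op t (env x (u c)) = (word (pair_up c) x * (word (pair_up c) b \\ y))%qdl.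
  rewrite /= !word_termE /= !env_pvar env0 /=.
  have -> // : pair_up (tnth (env x (u c)) \o (fun p => pvar (inr p))) = pair_up c.
  by apply: eq_map => i; rewrite /= !env_pvar.
have := @Q_abelian _ t b a [tuple u (@letter w) (enum_val i) | i < _]
   [tuple u (fun=> b) (enum_val i) | i < _].
rewrite -!/(env _ _) !tE pair_up_letter /pair_up !word_diag !qldivK.
exact.
Qed.

Lemma abelian_Dis_abelian : abelian_perm (Dis Q).
Proof.
move=> g h Dg /Dis_word[w ->].
have [v Ev] := Dis_word Dg.
have comm a b y : g (a * (b \\ y))%qdl = (a * (b \\ g y))%qdl.
  have gM := Dis_morph Dg.
  by rewrite gM (qldiv_morph gM) Ev abelian_word_gen.
by apply/funext=> y /=; elim: w => //= p w IH; rewrite comm IH.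
Qed.

End Words.

Theorem theorem2p2 (Q : quandle) :
  [<-> quasi_affine Q;
       abelian_perm (Dis Q) /\ semiregular (Dis Q);
       exists (A : zmodType) (f : automorphism A) (I : Type)
         (I_nonempty : inhabited I) (d : I -> A),
         isomorphic Q (Ext f I_nonempty d);
       abelian_quandle Q]
  /\ ((exists (A : zmodType) (f : automorphism A) (I : Type)
         (I_nonempty : inhabited I) (d : I -> A),
         isomorphic Q (Ext f I_nonempty d)) ->
      exists (A : zmodType) (f : automorphism A) (I : Type)
         (I_nonempty : inhabited I) (d : I -> A),
         isomorphic Q (Ext f I_nonempty d) /\ indecomposable f I_nonempty d).
Proof.
have Ext_ab : (exists (A : zmodType) (f : automorphism A) (I : Type)
    (I_nonempty : inhabited I) (d : I -> A),
    isomorphic Q (Ext f I_nonempty d)) -> abelian_quandle Q.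
  case=> A [f [I [I0 [d [h [hbij hM]]]]]].
  exact: abelian_quandle_sub (bij_inj hbij) hM (@Ext_abelian _ _ _ _ _).
have ab_Dis : abelian_quandle Q -> abelian_perm (Dis Q) /\ semiregular (Dis Q).
  by move=> abQ; split; [exact: abelian_Dis_abelian|exact: abelian_semiregular].
split; last by move=> /Ext_ab/ab_Dis[]; exact: semiregular_Ext.
tfae.
- exact: quasi_affine_Dis.
- case=> ab sr; have [A [f [I [I0 [d [iso _]]]]]] := semiregular_Ext ab sr.
  by exists A, f, I, I0, d.
- exact: Ext_ab.
- move=> /ab_Dis[ab sr]; apply/quasi_affineP.
  have [A [f [I [I0 [d [[h [hbij hM]] _]]]]]] := semiregular_Ext ab sr.
  exists _, (shear_aut f I), (@Ext_to_Aff _ f _ I0 d \o h); split.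
    exact: inj_comp (@Ext_to_Aff_inj _ _ _ _ _) (bij_inj hbij).
  by move=> x y; rewrite /= hM Ext_to_Aff_morph.
Qed.
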